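(* Let $n\ge m\ge k\ge1$ be integers. If $A$ is a $(0,1)$-matrix of size $m\times n$, then $$\|A\|_{F_k}\le\frac12\left(1+\sqrt{k}\right)\sqrt{mn}.$$ Equality holds if and only if the matrix $2A-J_{m,n}$ is plain and has exactly $k$ nonzero singular values, which are all equal. In particular, if $m=n=k$, equality holds if and only if $2A-J_{n,n}$ is a plain Hadamard matrix.
   Context: For an $m\times n$ complex matrix $A$, $\sigma_1(A)\ge\sigma_2(A)\ge\cdots\ge\sigma_m(A)$ are its singular values (square roots of the eigenvalues of $AA^*$), and $\|A\|_{F_k}=\sigma_1(A)+\cdots+\sigma_k(A)$ is the Ky Fan $k$-norm. $J_{m,n}$ is the $m\times n$ all-ones matrix. An $m\times n$ matrix $B$ is called plain if the all-ones vectors $\mathbf{j}_m\in\mathbb{R}^m$ and $\mathbf{j}_n\in\mathbb{R}^n$ are singular vectors to $\sigma_1(B)$, that is, $\sigma_1(B)=\langle \mathbf{j}_m,B\mathbf{j}_n\rangle/\sqrt{mn}$. An $n\times n$ matrix $B=[b_{ij}]$ is Hadamard if $|b_{ij}|=1$ for all $i,j$ and $BB^*=nI_n$. *)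

(* Defs.v *)
From HB Require Import structures.
From mathcomp Require Import all_boot all_order all_algebra.
From mathcomp Require Import complex.

Set Implicit Arguments.
Unset Strict Implicit.
Unset Printing Implicit Defensive.

Import Order.TTheory GRing.Theory Num.Theory.

Local Open Scope ring_scope.
Local Open Scope complex_scope.
Local Open Scope sesquilinear_scope.

Section SingularValues.
Variable R : rcfType.
Implicit Types m n k : nat.

(* Eigenvalues with algebraic multiplicity, in an unspecified order. *)
Definition eigenvalues n (M : 'M[R[i]]_n) : seq R[i] :=
  sval (closed_field_poly_normal (char_poly M)).

(* The eigenvalues of A A^* are real and nonnegative, so [complex.Re] only
   transports them from R[i] to R. *)
Definition singular_values m n (A : 'M[R[i]]_(m, n)) : seq R :=
  sort (fun x y => y <= x)
    [seq Num.sqrt (complex.Re z) | z <- eigenvalues (A *m A ^t*)].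

(* 0-based: [sigma A i] is the (i+1)-st largest singular value. *)
Definition sigma m n (A : 'M[R[i]]_(m, n)) (i : nat) : R :=
  nth 0 (singular_values A) i.

Definition ky_fan k m n (A : 'M[R[i]]_(m, n)) : R := \sum_(i < k) sigma A i.

Definition zero_one m n (A : 'M[R[i]]_(m, n)) : Prop :=
  forall i j, A i j = 0 \/ A i j = 1.

Definition ones_mx m n : 'M[R[i]]_(m, n) := const_mx 1.

Definition ones n : 'cV[R[i]]_n := const_mx 1.

Definition inner n (u v : 'cV[R[i]]_n) : R[i] := (u ^t* *m v) 0 0.

Definition plain m n (B : 'M[R[i]]_(m, n)) : Prop :=
  (sigma B 0)%:C = inner (ones m) (B *m ones n) / (Num.sqrt (m * n)%:R)%:C.

Definition exactly_k_equal_nonzero_sv k m n (B : 'M[R[i]]_(m, n)) : Prop :=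
  count (fun s => s != 0) (singular_values B) = k /\
  {in singular_values B &, forall s t, s != 0 -> t != 0 -> s = t}.

Definition hadamard n (B : 'M[R[i]]_n) : Prop :=
  (forall i j, `|B i j| = 1) /\ B *m B ^t* = n%:R%:M.

End SingularValues.

Arguments ones_mx {R} m n.
Arguments ones {R} n.

(* Main.v *)
(* Let B = 2A - J, so A = (J + B)/2, and let <M, N> = Re tr(M N^* ). The Ky Fan
   norm ||A||_k is the maximum of <A, W> over partial isometries W with
   <W, W> <= k. For such W, Cauchy-Schwarz gives
   <J, W> = <j_m, W j_n> <= sqrt(mn) and <B, W> <= sqrt(mn) sqrt(k), since B has
   entries +1 and -1. Equality in the second estimate means that B is a positive
   multiple of W with <W, W> = k, i.e. that B has exactly k nonzero singular
   values, all equal; equality in the first then says that B is plain. *)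
Require Import Defs.
From mathcomp Require Import all_boot all_order all_algebra.
From mathcomp Require Import complex reals.
From mathcomp Require Import perm ring lra.

Set Implicit Arguments.
Unset Strict Implicit.
Unset Printing Implicit Defensive.

Import Order.TTheory GRing.Theory Num.Theory.

Local Open Scope ring_scope.
Local Open Scope complex_scope.
Local Open Scope sesquilinear_scope.

(** * Real Frobenius inner product, Cauchy-Schwarz and partial isometries *)

Section FrobeniusProduct.
Variable R : rcfType.
Implicit Types m n p : nat.

Lemma conjCE (z : R[i]) : Num.conj z = z^*%C.
Proof. by []. Qed.

Lemma ReD (x y : R[i]) : complex.Re (x + y) = complex.Re x + complex.Re y.
Proof. by case: x y => [? ?] [? ?]. Qed.

Lemma ReN (x : R[i]) : complex.Re (- x) = - complex.Re x.
Proof. by case: x. Qed.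

Lemma ReZ (a : R) (x : R[i]) : complex.Re (a%:C * x) = a * complex.Re x.
Proof. by case: x => [b c] /=; rewrite mul0r subr0. Qed.

Lemma Re_sum I (r : seq I) P (F : I -> R[i]) :
  complex.Re (\sum_(i <- r | P i) F i) = \sum_(i <- r | P i) complex.Re (F i).
Proof. by elim/big_rec2: _ => // i x y _ <-; rewrite ReD. Qed.

Lemma ctrmxM m n p (M : 'M[R[i]]_(m, n)) (N : 'M[R[i]]_(n, p)) :
  (M *m N)^t* = N^t* *m M^t*.
Proof. by rewrite trmx_mul map_mxM. Qed.

Lemma ctrmxZ m n (a : R) (M : 'M[R[i]]_(m, n)) : (a%:C *: M)^t* = a%:C *: M^t*.
Proof. by rewrite linearZ /= map_mxZ /= conjCE conjc_real. Qed.

(** Taking the real part of the Hermitian Frobenius product yields a symmetric [R]-bilinear form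
    with values in the ordered field [R]. *)
Definition dot m n (M N : 'M[R[i]]_(m, n)) : R := complex.Re (\tr (M *m N^t*)).

Lemma dotE m n (M N : 'M[R[i]]_(m, n)) :
  dot M N = \sum_i \sum_j complex.Re (M i j * (N i j)^*%C).
Proof.
rewrite /dot /mxtrace Re_sum; apply: eq_bigr => i _.
by rewrite mxE Re_sum; apply: eq_bigr => j _; rewrite !mxE.
Qed.

Lemma dotC m n (M N : 'M[R[i]]_(m, n)) : dot M N = dot N M.
Proof.
rewrite !dotE; apply: eq_bigr => i _; apply: eq_bigr => j _.
by case: (M i j) (N i j) => [a b] [c d] /=; ring.
Qed.

Lemma dotDl m n (M N K : 'M[R[i]]_(m, n)) : dot (M + N) K = dot M K + dot N K.
Proof. by rewrite /dot mulmxDl mxtraceD ReD. Qed.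

Lemma dotZl m n (a : R) (M N : 'M[R[i]]_(m, n)) :
  dot (a%:C *: M) N = a * dot M N.
Proof. by rewrite /dot -scalemxAl mxtraceZ ReZ. Qed.

Lemma dotDr m n (M N K : 'M[R[i]]_(m, n)) : dot K (M + N) = dot K M + dot K N.
Proof. by rewrite dotC dotDl ![dot _ K]dotC. Qed.

Lemma dotZr m n (a : R) (M N : 'M[R[i]]_(m, n)) :
  dot M (a%:C *: N) = a * dot M N.
Proof. by rewrite dotC dotZl dotC. Qed.

Lemma dot_mull m n p (P : 'M[R[i]]_(p, m)) (M : 'M[R[i]]_(m, n)) N :
  dot (P *m M) N = dot M (P^t* *m N).
Proof. by rewrite /dot ctrmxM trmxCK -mulmxA mxtrace_mulC mulmxA. Qed.

Lemma dot_mulr m n p (Q : 'M[R[i]]_(n, p)) (M : 'M[R[i]]_(m, n)) N :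
  dot (M *m Q) N = dot M (N *m Q^t*).
Proof. by rewrite /dot ctrmxM trmxCK mulmxA. Qed.

Lemma dot_adj m n (M N : 'M[R[i]]_(m, n)) : dot (M^t*) (N^t*) = dot M N.
Proof. by rewrite dotC /dot trmxCK mxtrace_mulC. Qed.

Lemma dot_term_ge0 (z : R[i]) : 0 <= complex.Re (z * z^*%C).
Proof. by case: z => a b /=; nra. Qed.

Lemma mulJ_real (z : R[i]) : z * z^*%C = (complex.Re (z * z^*%C))%:C.
Proof.
by case: z => a b; apply/eqP; rewrite eq_complex /= eqxx; apply/eqP; ring.
Qed.

Lemma dot_ge0 m n (M : 'M[R[i]]_(m, n)) : 0 <= dot M M.
Proof.
by rewrite dotE; do 2!apply: sumr_ge0 => ? _; apply: dot_term_ge0.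
Qed.

Lemma dot_le0_eq0 m n (M : 'M[R[i]]_(m, n)) : dot M M <= 0 -> M = 0.
Proof.
move=> M0; have {M0} : dot M M = 0 by apply/eqP; rewrite eq_le M0 dot_ge0.
rewrite dotE => /psumr_eq0P H; apply/matrixP => i j.
have /psumr_eq0P Hi : \sum_j complex.Re (M i j * (M i j)^*%C) = 0.
  by apply: H => // ? _; apply: sumr_ge0 => ? _; apply: dot_term_ge0.
have := Hi (fun j _ => dot_term_ge0 _) j isT.
rewrite mxE; case: (M i j) => a b /= ab.
have [-> ->] : a = 0 /\ b = 0 by split; apply/eqP; rewrite -sqrf_eq0; nra.
by [].
Qed.

Lemma dot_rows m n (M N : 'M[R[i]]_(m, n)) :
  \sum_i dot (row i M) (row i N) = dot M N.
Proof.
rewrite dotE; apply: eq_bigr => i _; rewrite dotE big_ord1.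
by apply: eq_bigr => j _; rewrite !mxE.
Qed.

Lemma dot_row m n (M N : 'M[R[i]]_(m, n)) i :
  dot (row i M) (row i N) = complex.Re ((M *m N^t*) i i).
Proof.
by rewrite dotE big_ord1 mxE Re_sum; apply: eq_bigr => j _; rewrite !mxE.
Qed.

Lemma dot_sqrD m n (a b : R) (M N : 'M[R[i]]_(m, n)) :
  dot (b%:C *: M + (- a)%:C *: N) (b%:C *: M + (- a)%:C *: N)
  = b ^+ 2 * dot M M - 2 * (a * b * dot M N) + a ^+ 2 * dot N N.
Proof. by rewrite !dotDl !dotDr !dotZl !dotZr (dotC N M); ring. Qed.

(** Expand the nonnegative squared norm of [b M - a N] and divide by [2 a b]. Stating the bound
    through [a] and [b] avoids square roots of norms. *)
Lemma dot_CS m n (a b : R) (M N : 'M[R[i]]_(m, n)) : 0 < a -> 0 < b ->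
  dot M M <= a ^+ 2 -> dot N N <= b ^+ 2 -> dot M N <= a * b.
Proof.
move=> a0 b0 Ma Nb; have := dot_ge0 (b%:C *: M + (- a)%:C *: N).
rewrite dot_sqrD => H.
have ab0 : 0 < a * b by rewrite mulr_gt0.
rewrite -(ler_pM2l ab0).
have : b ^+ 2 * dot M M <= b ^+ 2 * a ^+ 2 by rewrite ler_wpM2l ?sqr_ge0.
have : a ^+ 2 * dot N N <= a ^+ 2 * b ^+ 2 by rewrite ler_wpM2l ?sqr_ge0.
nra.
Qed.

(** In the equality case the same expansion makes the squared norm of [b M - a N] at most 0. *)
Lemma dot_CS_eq m n (a b : R) (M N : 'M[R[i]]_(m, n)) :
  dot M M <= a ^+ 2 -> dot N N <= b ^+ 2 -> dot M N = a * b ->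
  b%:C *: M = a%:C *: N.
Proof.
move=> Ma Nb MN; apply/eqP; rewrite -subr_eq0 -scaleNr -raddfN; apply/eqP.
apply: dot_le0_eq0; rewrite dot_sqrD MN.
have : b ^+ 2 * dot M M <= b ^+ 2 * a ^+ 2 by rewrite ler_wpM2l ?sqr_ge0.
have : a ^+ 2 * dot N N <= a ^+ 2 * b ^+ 2 by rewrite ler_wpM2l ?sqr_ge0.
nra.
Qed.

(** This equation says that [W] is isometric on the orthogonal complement of its kernel; it makes
    [W W^*] and [W^* W] orthogonal projections. *)
Definition partial_isometry m n (W : 'M[R[i]]_(m, n)) :=
  W *m W^t* *m W = W.

Lemma partial_isometry_adj m n (W : 'M[R[i]]_(m, n)) :
  partial_isometry W -> partial_isometry (W^t*).
Proof.
move=> /(congr1 (fun M => M^t*)) WE.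
by rewrite /partial_isometry -mulmxA -!ctrmxM.
Qed.

(** With the projection [E = W^* W], the squared norms of [W M] and [E M] both equal [<M, E M>], and
    the defect is the squared norm of [M - E M]. *)
Lemma partial_isometry_le m n p (W : 'M[R[i]]_(m, n)) (M : 'M_(n, p)) :
  partial_isometry W -> dot (W *m M) (W *m M) <= dot M M.
Proof.
move=> WE; set E := W^t* *m W.
have EE : E *m E = E by rewrite /E -mulmxA (mulmxA W) WE.
have Ea : E^t* = E by rewrite /E ctrmxM trmxCK.
have -> : dot (W *m M) (W *m M) = dot M (E *m M) by rewrite dot_mull mulmxA.
have := dot_ge0 (1%:C *: M + (- 1)%:C *: (E *m M)); rewrite dot_sqrD.
have -> : dot (E *m M) (E *m M) = dot M (E *m M).
  by rewrite dot_mull Ea mulmxA EE.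
lra.
Qed.

Lemma partial_isometry_le_r m n p (W : 'M[R[i]]_(m, n)) (M : 'M_(p, m)) :
  partial_isometry W -> dot (M *m W) (M *m W) <= dot M M.
Proof.
move=> /partial_isometry_adj Wa; have := partial_isometry_le (M^t*) Wa.
by rewrite -ctrmxM !dot_adj.
Qed.

End FrobeniusProduct.

(** * Singular value decomposition with sorted singular values *)

Section SingularValueDecomposition.
Variable R : rcfType.
Implicit Types m n p : nat.

Definition rdiag m (f : 'I_m -> R) : 'M[R[i]]_m := diag_mx (\row_i (f i)%:C).

Lemma eq_rdiag m (f g : 'I_m -> R) : f =1 g -> rdiag f = rdiag g.
Proof. by move=> fg; congr diag_mx; apply/rowP => i; rewrite !mxE fg. Qed.

Lemma rdiagM m (f g : 'I_m -> R) :
  rdiag f *m rdiag g = rdiag (fun i => f i * g i).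
Proof.
by rewrite mulmx_diag; congr diag_mx; apply/rowP => i; rewrite !mxE rmorphM.
Qed.

Lemma rdiag_adj m (f : 'I_m -> R) : (rdiag f)^t* = rdiag f.
Proof.
rewrite /rdiag tr_diag_mx map_diag_mx; congr diag_mx.
by apply/rowP => i; rewrite !mxE [LHS]conjc_real.
Qed.

Lemma rdiag_const m (a : R) : rdiag (fun _ : 'I_m => a) = (a%:C)%:M.
Proof.
by rewrite -diag_const_mx; congr diag_mx; apply/rowP => i; rewrite !mxE.
Qed.

Lemma rdiag_inj m (f g : 'I_m -> R) : rdiag f = rdiag g -> f =1 g.
Proof.
by move=> /matrixP fg i; have := fg i i; rewrite !mxE eqxx !mulr1n => -[].
Qed.

Lemma Re_tr_rdiag m (f : 'I_m -> R) : complex.Re (\tr (rdiag f)) = \sum_i f i.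
Proof. by rewrite mxtrace_diag Re_sum; apply: eq_bigr => i _; rewrite mxE. Qed.

Lemma row_rdiag_mul m n (f : 'I_m -> R) (M : 'M[R[i]]_(m, n)) i :
  row i (rdiag f *m M) = (f i)%:C *: row i M.
Proof. by apply/rowP => j; rewrite mul_diag_mx !mxE. Qed.

Lemma dot_rdiag m n (f : 'I_m -> R) (M N : 'M[R[i]]_(m, n)) :
  dot (rdiag f *m M) N = \sum_i f i * dot (row i M) (row i N).
Proof.
by rewrite -dot_rows; apply: eq_bigr => i _; rewrite row_rdiag_mul dotZl.
Qed.

Lemma mulmx_adj_row_perm m (s : 'S_m) (P : 'M[R[i]]_m) (B : 'M[R[i]]_m) i j :
  (row_perm s P *m B *m (row_perm s P)^t*) i j = (P *m B *m P^t*) (s i) (s j).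
Proof.
rewrite !mxE; apply: eq_bigr => l _.
by rewrite !mxE; congr (_ * _); apply: eq_bigr => l' _; rewrite !mxE.
Qed.

(** Similarity invariance: [X - P M P^*] factors over the polynomial ring as [Q (X - M) Q'] with
    [Q Q' = 1], so the determinants of [Q] and [Q'] cancel. *)
Lemma char_poly_unitary_diag m (P M : 'M[R[i]]_m) (d : 'rV[R[i]]_m) :
  P *m P^t* = 1%:M -> P *m M *m P^t* = diag_mx d ->
  char_poly M = \prod_(i < m) ('X - (d 0 i)%:P).
Proof.
move=> PP PMP; have <- : char_poly (diag_mx d) = char_poly M.
  rewrite -PMP /char_poly /char_poly_mx !map_mxM /=.
  set Q := map_mx _ P; set Q' := map_mx polyC (P^t*).
  have QQ : Q *m Q' = 1%:M by rewrite -map_mxM PP map_mx1.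
  have -> : 'X%:M - Q *m map_mx polyC M *m Q'
            = Q *m ('X%:M - map_mx polyC M) *m Q'.
    by rewrite mulmxBr mulmxBl (scalar_mxC _ Q) -(mulmxA 'X%:M) QQ mulmx1.
  by rewrite -{1}/Q -!/Q' !det_mulmx mulrAC -det_mulmx QQ det1 mul1r.
rewrite char_poly_trig ?diag_mx_is_trig //.
by apply: eq_bigr => i _; rewrite mxE eqxx mulr1n.
Qed.

Lemma eigenvalues_unitary_diag m (P M : 'M[R[i]]_m) (d : 'rV[R[i]]_m) :
  P *m P^t* = 1%:M -> P *m M *m P^t* = diag_mx d ->
  perm_eq (eigenvalues M) [seq d 0 i | i <- enum 'I_m].
Proof.
move=> PP PMP; apply: prod_XsubC_eq.
rewrite /eigenvalues; case: closed_field_poly_normal => /= r.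
rewrite (monicP (char_poly_monic M)) scale1r => <-.
by rewrite (char_poly_unitary_diag PP PMP) big_map big_enum.
Qed.

Lemma size_singular_values m n (A : 'M[R[i]]_(m, n)) :
  size (singular_values A) = m.
Proof.
rewrite size_sort size_map /eigenvalues.
case: closed_field_poly_normal => /= r.
rewrite (monicP (char_poly_monic _)) scale1r.
move=> /(congr1 (@size _ : {poly _} -> _)).
by rewrite size_char_poly size_prod_XsubC => -[].
Qed.

Lemma sigma_ge0 m n (A : 'M[R[i]]_(m, n)) i : 0 <= sigma A i.
Proof.
rewrite /sigma; have [lt_i|ge_i] := ltnP i (size (singular_values A)).
  have := mem_nth 0 lt_i; rewrite mem_sort => /mapP[z _ ->].
  exact: sqrtr_ge0.
by rewrite nth_default.
Qed.

(** Past the end of the list [sigma] takes the default value 0, which respects the order because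
    singular values are nonnegative. *)
Lemma sigma_anti m n (A : 'M[R[i]]_(m, n)) i j :
  (i <= j)%N -> sigma A j <= sigma A i.
Proof.
move=> ij; have [lt_j|ge_j] := ltnP j (size (singular_values A)); last first.
  by rewrite {1}/sigma nth_default ?sigma_ge0.
apply: (@sorted_leq_nth _ (fun x y : R => y <= x)) => //.
- by move=> x y z yx xz; apply: le_trans xz yx.
- by apply: sort_sorted => x y; rewrite orbC le_total.
- by rewrite inE (leq_ltn_trans ij).
Qed.

(** The spectral theorem diagonalizes [A A^*] in an unspecified order; permuting the rows of the
    unitary matrix puts the eigenvalues in the order of [sigma]. *)
Lemma sorted_diagonalization m n (A : 'M[R[i]]_(m, n)) :
  exists P : 'M[R[i]]_m, P *m P^t* = 1%:M
    /\ P *m (A *m A^t*) *m P^t* = rdiag (fun i : 'I_m => sigma A i ^+ 2).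
Proof.
set M := A *m A^t*.
have Mnormal : M \is normalmx by apply/normalmxP; rewrite !ctrmxM !trmxCK.
set P := spectralmx M; set d := spectral_diag M.
have Pu : P \is unitarymx := spectral_unitarymx M.
have PP : P *m P^t* = 1%:M by apply/unitarymxP.
have PMP : P *m M *m P^t* = diag_mx d.
  rewrite (orthomx_spectralP Mnormal) -/P -/d invmx_unitary //.
  by rewrite !mulmxA PP mul1mx -mulmxA PP mulmx1.
(* Each diagonal entry is the squared norm of a row of [P A], hence real and nonnegative, so taking
   real part and square root loses nothing. *)
have dE i : d 0 i = (Num.sqrt (complex.Re (d 0 i)) ^+ 2)%:C.
  have : d 0 i = (P *m A *m (P *m A)^t*) i i.
    by rewrite ctrmxM !mulmxA -(mulmxA P) PMP mxE eqxx mulr1n.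
  have -> : (P *m A *m (P *m A)^t*) i i
            = (\sum_j complex.Re ((P *m A) i j * ((P *m A) i j)^*%C))%:C.
    rewrite mxE rmorph_sum; apply: eq_bigr => j _.
    by rewrite [X in _ * X = _]mxE [_^T j i]mxE -[RHS]mulJ_real.
  move=> ->; rewrite sqr_sqrtr //.
  by apply: sumr_ge0 => j _; apply: dot_term_ge0.
have pe : perm_eq (singular_values A)
    [tuple Num.sqrt (complex.Re (d 0 i)) | i < m].
  rewrite perm_sort.
  have := perm_map (fun z => Num.sqrt (complex.Re z))
    (eigenvalues_unitary_diag PP PMP).
  by rewrite -map_comp.
have [s sE] := tuple_permP pe.
exists (row_perm s P); split; apply/matrixP => i j.
  rewrite -{1}[row_perm s P]mulmx1 mulmx_adj_row_perm mulmx1 PP !mxE.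
  by rewrite (inj_eq perm_inj).
rewrite mulmx_adj_row_perm PMP !mxE (inj_eq perm_inj) dE.
congr ((_ ^+ 2)%:C *+ _).
by rewrite /sigma sE -tnth_nth !tnth_mktuple.
Qed.

(** Here [V] is [m] by [n] and its rows at zero singular values vanish. It is thus only a partial
    isometry, and no orthonormal basis has to be completed. *)
Lemma svd m n (A : 'M[R[i]]_(m, n)) :
  exists P V, [/\ P *m P^t* = 1%:M, P^t* *m P = 1%:M,
    A = P^t* *m (rdiag (fun i : 'I_m => sigma A i) *m V),
    V *m V^t* = rdiag (fun i : 'I_m => (sigma A i != 0)%:R)
    & partial_isometry V].
Proof.
have [P [PP PAP]] := sorted_diagonalization A.
set s := fun i : 'I_m => sigma A i.
have P'P : P^t* *m P = 1%:M by apply: mulmx1C.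
set C := P *m A; have CC : C *m C^t* = rdiag (fun i => s i ^+ 2).
  by rewrite ctrmxM !mulmxA -(mulmxA P).
(* Since the inverse of 0 is 0, this normalizes the nonzero rows of [C] and gives zero rows where
   [s i = 0]. *)
set V := rdiag (fun i => (s i)^-1) *m C; exists P, V.
have VV : V *m V^t* = rdiag (fun i => (s i != 0)%:R).
  rewrite ctrmxM rdiag_adj !mulmxA -(mulmxA _ C) CC !rdiagM.
  apply: eq_rdiag => i.
  by case: eqP => [->|/eqP s0] /=; [rewrite invr0 mulr0 | field].
have CE : C = rdiag s *m V.
  rewrite mulmxA rdiagM; apply/matrixP => i j; rewrite mul_diag_mx [RHS]mxE.
  rewrite [X in _ = X * _]mxE.
  (* Where [s i = 0], row [i] of [C] has squared norm 0, so the factorization holds there too. *)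
  have [s0|s0] := eqVneq (s i) 0; last by rewrite divff // mul1r.
  rewrite s0 mul0r mul0r; have Ci0 : row i C = 0.
    by apply: dot_le0_eq0; rewrite dot_row CC !mxE eqxx s0 expr0n.
  by have /rowP/(_ j) := Ci0; rewrite !mxE.
split=> //; first by rewrite -CE mulmxA P'P mul1mx.
rewrite /partial_isometry VV mulmxA rdiagM; congr (_ *m C).
apply: eq_rdiag => i.
by case: eqP => [->|_] /=; rewrite ?invr0 ?mulr0 ?mul1r.
Qed.

End SingularValueDecomposition.

(** * Ky Fan norm as a maximum over partial isometries *)

Section KyFan.
Variable R : rcfType.
Implicit Types m n k : nat.

Lemma sum_ord_widen_indicator m k (f : nat -> R) : (k <= m)%N ->
  \sum_(i < k) f i = \sum_(i < m) (i < k)%N%:R * f i.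
Proof.
move=> km; rewrite (big_ord_widen m f km) big_mkcond /=; apply: eq_bigr => i _.
by case: ltnP; rewrite ?mul1r ?mul0r.
Qed.

Lemma sum_indicator m k : (k <= m)%N ->
  \sum_(i < m) (i < k)%N%:R = k%:R :> R.
Proof.
move=> km; have := sum_ord_widen_indicator (fun=> 1) km.
under [X in _ = X -> _]eq_bigr do rewrite mulr1.
by move=> <-; rewrite sumr_const card_ord.
Qed.

(** Fractional knapsack with threshold [s k]: termwise, [s i] times [u i] minus the indicator of
    [i < k] is at most [s k] times it, since [s i - s k] and that difference have opposite signs. *)
Lemma sum_le_top m k (s : nat -> R) (u : 'I_m -> R) : (k <= m)%N ->
  {homo s : i j / (i <= j)%N >-> j <= i} -> (forall i, 0 <= s i) ->
  (forall i, 0 <= u i <= 1) -> \sum_i u i <= k%:R ->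
  \sum_(i < m) s i * u i <= \sum_(i < k) s i.
Proof.
move=> km s_anti s0 u01 uk; rewrite (sum_ord_widen_indicator s km).
have tk : s k * \sum_i (u i - (i < k)%N%:R) <= 0.
  by rewrite sumrB mulr_ge0_le0 ?s0 // subr_le0 sum_indicator.
rewrite -subr_le0 -sumrB; apply: le_trans tk; rewrite mulr_sumr.
apply: ler_sum => i _; have /andP[ui0 ui1] := u01 i.
case: ltnP => [/ltnW|] /s_anti sik.
  have : 0 <= (s i - s k) * (1 - u i) by rewrite mulr_ge0 // subr_ge0.
  rewrite mulr1n mul1r; lra.
have : 0 <= (s k - s i) * u i by rewrite mulr_ge0 // subr_ge0.
rewrite mulr0n mul0r; lra.
Qed.

(** The maximizer keeps the first [k] rows of [V] in the decomposition. Some of these rows are zero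
    when the rank is below [k], so [dot W W] is only bounded by [k]. *)
Lemma ky_fan_attained m n k (A : 'M[R[i]]_(m, n)) : (k <= m)%N ->
  exists W, [/\ partial_isometry W, dot W W <= k%:R & dot A W = ky_fan k A].
Proof.
move=> km; have [P [V [PP P'P AE VV VI]]] := svd A.
set s := fun i : 'I_m => sigma A i in AE VV.
set e := fun i : 'I_m => (i < k)%N%:R : R.
have Vrow i : dot (row i V) (row i V) = (s i != 0)%:R.
  by rewrite dot_row VV !mxE eqxx.
have dotPP (M N : 'M_(m, n)) : dot (P^t* *m M) (P^t* *m N) = dot M N.
  by rewrite dot_mull trmxCK mulmxA PP mul1mx.
exists (P^t* *m (rdiag e *m V)); split.
- have ee : rdiag e *m rdiag e = rdiag e.
    by rewrite rdiagM; apply: eq_rdiag => i; rewrite /e -natrM mulnb andbb.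
  rewrite /partial_isometry !ctrmxM trmxCK rdiag_adj -!mulmxA; congr (_ *m _).
  rewrite (mulmxA P) PP mul1mx (mulmxA (rdiag e) _ V) ee (mulmxA V) VV.
  (* The truncation [rdiag e] commutes with the diagonal matrix [V V^*], so [V V^* V = V] survives
     truncation. *)
  have dC (f g : 'I_m -> R) : rdiag f *m rdiag g = rdiag g *m rdiag f.
    by rewrite !rdiagM; apply: eq_rdiag => i; rewrite mulrC.
  rewrite (mulmxA _ _ V) dC -(mulmxA _ _ V) -{1}VV VI.
  by rewrite mulmxA ee.
- rewrite dotPP dot_rdiag (le_trans (y := \sum_i e i)) //.
    apply: ler_sum => i _; rewrite row_rdiag_mul dotZr Vrow /e.
    by case: ltnP; case: (_ != _); rewrite ?mulr1 ?mulr0 ?mul0r.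
  by rewrite sum_indicator.
- rewrite {1}AE dotPP dotC dot_rdiag /ky_fan (sum_ord_widen_indicator _ km).
  apply: eq_bigr => i _; congr (_ * _); rewrite row_rdiag_mul dotZr Vrow.
  case: eqP => /= [si0|_]; last by rewrite mulr1.
  by rewrite mulr0 -si0.
Qed.

(** After a unitary change of basis, [dot A W] is a combination of the [sigma A i] with weights
    bounded by numbers [u i] in [[0, 1]] of total at most [k]; [sum_le_top] then applies. *)
Lemma ky_fan_max m n k (A W : 'M[R[i]]_(m, n)) : (k <= m)%N ->
  partial_isometry W -> dot W W <= k%:R -> dot A W <= ky_fan k A.
Proof.
move=> km WI Wk; have [P [V [PP P'P AE _ VI]]] := svd A.
set s := fun i : 'I_m => sigma A i in AE.
set Y := P *m W.
have YI : partial_isometry Y.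
  rewrite /partial_isometry ctrmxM !mulmxA -(mulmxA _ _ P) P'P mulmx1.
  by rewrite -!(mulmxA P) WI.
have Yk : dot Y Y <= k%:R by rewrite dot_mull mulmxA P'P mul1mx.
have -> : dot A W = \sum_i s i * dot (row i V) (row i Y).
  by rewrite {1}AE dot_mull trmxCK dot_rdiag.
move: Y YI Yk => {W WI Wk} Y YI Yk; set E := Y *m Y^t*.
have EI : partial_isometry E.
  by rewrite /partial_isometry /E ctrmxM trmxCK !mulmxA YI YI.
set q := fun i => row i (1%:M : 'M[R[i]]_m).
have dotq i : dot (q i) (q i) = 1.
  by rewrite dot_row trmx1 map_mx1 mulmx1 mxE eqxx.
have rowE p (M : 'M[R[i]]_(m, p)) i : row i M = q i *m M.
  by rewrite -row_mul mul1mx.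
(* AM-GM, after inserting the projection [E] that fixes [Y] on the left *)
set u := fun i => (dot (row i V *m Y^t*) (row i V *m Y^t*)
                   + dot (q i *m E) (q i *m E)) / 2.
have wu i : dot (row i V) (row i Y) <= u i.
  have -> : dot (row i V) (row i Y) = dot (row i V *m Y^t*) (q i *m E).
    by rewrite dot_mulr trmxCK -mulmxA YI -rowE.
  have := dot_ge0 (1%:C *: (row i V *m Y^t*) + (- 1)%:C *: (q i *m E)).
  rewrite dot_sqrD /u; lra.
(* The matrices [V], [Y^*] and [E] are contractions and [q i] is a unit vector, so each half of
   [u i] is at most 1/2. *)
have u01 i : 0 <= u i <= 1.
  have := partial_isometry_le_r (row i V) (partial_isometry_adj YI).
  have := partial_isometry_le_r (q i) EI.
  have := partial_isometry_le_r (q i) VI.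
  rewrite -rowE dotq /u.
  have := dot_ge0 (row i V *m Y^t*); have := dot_ge0 (q i *m E); lra.
(* Summing over rows gives half the squared norms of [V Y^*] and [Y Y^*], each at most that of
   [Y]. *)
have uk : \sum_i u i <= k%:R.
  rewrite -mulr_suml big_split /=.
  have -> : \sum_i dot (row i V *m Y^t*) (row i V *m Y^t*)
            = dot (V *m Y^t*) (V *m Y^t*).
    by rewrite -dot_rows; apply: eq_bigr => i _; rewrite row_mul.
  have -> : \sum_i dot (q i *m E) (q i *m E) = dot E E.
    by rewrite -dot_rows; apply: eq_bigr => i _; rewrite -rowE.
  have := partial_isometry_le (Y^t*) VI.
  have := partial_isometry_le_r Y (partial_isometry_adj YI).
  rewrite dot_adj -/E; lra.
apply: (le_trans (y := \sum_i s i * u i)).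
  by apply: ler_sum => i _; rewrite ler_wpM2l ?sigma_ge0.
by apply: sum_le_top => // [i j|i]; [apply: sigma_anti | apply: sigma_ge0].
Qed.

End KyFan.

(** * Equal nonzero singular values and multiples of partial isometries *)

Section EqualSingularValues.
Variable R : rcfType.
Implicit Types m n k : nat.

Lemma sum_sqr_sigma m n (B : 'M[R[i]]_(m, n)) :
  \sum_(i < m) sigma B i ^+ 2 = dot B B.
Proof.
have [P [PP PBP]] := sorted_diagonalization B.
by rewrite -Re_tr_rdiag -PBP mxtrace_mulC (mulmxA _ P) (mulmx1C PP) mul1mx.
Qed.

Lemma count_nonzero_sigma m n (B : 'M[R[i]]_(m, n)) :
  (count (fun s => s != 0) (singular_values B))%:R
  = \sum_(i < m) (sigma B i != 0)%:R :> R.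
Proof.
rewrite -sum1_count (big_nth 0) size_singular_values big_mkord natr_sum.
rewrite big_mkcond.
by apply: eq_bigr => i _; rewrite /sigma; case: ifP.
Qed.

Lemma sigma0_gt0 m n (B : 'M[R[i]]_(m, n)) :
  (0 < count (fun s => s != 0%R) (singular_values B))%N -> 0 < sigma B 0.
Proof.
move=> cnt0; rewrite lt_def sigma_ge0 andbT; apply: contraTneq cnt0 => s0.
rewrite -leqNgt leqn0 -(pnatr_eq0 R) count_nonzero_sigma big1 // => i _.
have : sigma B i <= 0 by rewrite -s0 sigma_anti.
by rewrite le_eqVlt ltNge sigma_ge0 orbF => /eqP ->; rewrite eqxx.
Qed.

(** Take [W = B / c] with [c] the common nonzero singular value: the decomposition gives
    [B B^* B = c^2 B], and the sum of squared singular values is [k c^2]. *)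
Lemma exactly_k_partial_isometry m n k (B : 'M[R[i]]_(m, n)) : (0 < k)%N ->
  exactly_k_equal_nonzero_sv k B ->
  exists W, [/\ partial_isometry W, dot W W = k%:R, 0 < sigma B 0
    & B = (sigma B 0)%:C *: W].
Proof.
move=> k0 [Bk Beq]; set c := sigma B 0.
have sum_k : \sum_(i < m) (sigma B i != 0)%:R = k%:R :> R.
  by rewrite -count_nonzero_sigma Bk.
have c0 : 0 < c by rewrite sigma0_gt0 ?Bk.
have sigma_mem (i : 'I_m) : sigma B i \in singular_values B.
  by rewrite mem_nth // size_singular_values.
have sigmaE (i : 'I_m) : sigma B i = (sigma B i != 0)%:R * c.
  have [->|si0] := eqVneq (sigma B i) 0; first by rewrite mul0r.
  rewrite mul1r; apply: Beq => //; last by rewrite gt_eqF.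
  by rewrite mem_nth // size_singular_values (leq_ltn_trans _ (ltn_ord i)).
have BBB : B *m B^t* *m B = (c ^+ 2)%:C *: B.
  have [P [V [PP _ BE VV _]]] := svd B.
  rewrite {1 2 3}BE !ctrmxM trmxCK rdiag_adj -!mulmxA (mulmxA P) PP mul1mx.
  rewrite (mulmxA V) VV [X in _ *: X]BE scalemxAr; congr (_ *m _).
  rewrite !mulmxA !rdiagM scalemxAl; congr (_ *m V).
  rewrite -mul_scalar_mx -rdiag_const rdiagM; apply: eq_rdiag => i.
  by have := sigmaE i; case: eqP => [->|_] /= ->; ring.
exists ((c^-1)%:C *: B); split=> //.
- rewrite /partial_isometry ctrmxZ -!(scalemxAl, scalemxAr) BBB !scalerA.
  rewrite -!rmorphM /=; congr (_%:C *: _); field; exact: lt0r_neq0.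
- rewrite dotZl dotZr -sum_sqr_sigma -sum_k !mulr_sumr; apply: eq_bigr => i _.
  rewrite {1}sigmaE; case: (_ != _) => /=; last by ring.
  by field; exact: lt0r_neq0.
- by rewrite scalerA -rmorphM divff ?gt_eqF // scale1r.
Qed.

(** For [B = c W], the square of [B B^*] is [c^2] times itself, so each singular value is 0 or [c];
    the squared norm [c^2 k] then counts the nonzero ones. *)
Lemma partial_isometry_exactly_k m n k (c : R) (W : 'M[R[i]]_(m, n)) :
  (0 < k)%N -> 0 < c -> partial_isometry W -> dot W W = k%:R ->
  sigma (c%:C *: W) 0 = c /\ exactly_k_equal_nonzero_sv k (c%:C *: W).
Proof.
move=> k0 c0 WI Wk; set B := c%:C *: W.
have sigma_c (i : 'I_m) : sigma B i != 0 -> sigma B i = c.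
  have [P [PP PBP]] := sorted_diagonalization B.
  have BB : (B *m B^t*) *m (B *m B^t*) = (c ^+ 2)%:C *: (B *m B^t*).
    rewrite /B ctrmxZ -!(scalemxAl, scalemxAr) mulmxA WI !scalerA -!rmorphM /=.
    by congr (_%:C *: _); ring.
  set D := rdiag _ in PBP; have : D *m D = ((c ^+ 2)%:C)%:M *m D.
    rewrite mul_scalar_mx -PBP -!mulmxA (mulmxA _ P) (mulmx1C PP) mul1mx.
    rewrite scalemxAr; congr (_ *m _).
    by rewrite !mulmxA -(mulmxA (B *m B^t*)) BB -scalemxAl.
  rewrite -rdiag_const !rdiagM.
  move=> /rdiag_inj/(_ i) ss si0.
  have /eqP : sigma B i ^+ 2 = c ^+ 2 by apply: (mulIf _ ss); rewrite sqrf_eq0.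
  by rewrite eqrXn2 ?sigma_ge0 ?ltW // => /eqP.
have Bk : count (fun s => s != 0) (singular_values B) = k.
  apply/eqP; rewrite -(eqr_nat R) count_nonzero_sigma.
  have c2 : c ^+ 2 != 0 by rewrite sqrf_eq0 gt_eqF.
  apply/eqP/(mulfI c2); rewrite -Wk.
  have <- : dot B B = c ^+ 2 * dot W W by rewrite dotZl dotZr; ring.
  rewrite -sum_sqr_sigma mulr_sumr; apply: eq_bigr => i _.
  by have [->|/sigma_c ->] := eqVneq (sigma B i) 0; rewrite ?mulr1 //
    mulr0 expr0n.
(* Index 0 must denote an actual singular value rather than the default. *)
have m0 : (0 < m)%N.
  rewrite (leq_trans k0) // -Bk; apply: leq_trans (count_size _ _) _.
  by rewrite size_singular_values.
have Beq s : s \in singular_values B -> s != 0 -> s = c.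
  move=> sB; case/(nthP (0 : R)): sB => i.
  rewrite size_singular_values => im <-.
  exact: (sigma_c (Ordinal im)).
split; last by split=> // s t /Beq sc /Beq tc /sc -> /tc ->.
by apply: (sigma_c (Ordinal m0)); rewrite gt_eqF ?sigma0_gt0 ?Bk.
Qed.

End EqualSingularValues.

(** * Plain, sign and Hadamard matrices *)

Section SignMatrices.
Variable R : rcfType.
Implicit Types m n k : nat.

Lemma dot_ones m : dot (ones m : 'cV[R[i]]_m) (ones m) = m%:R.
Proof.
rewrite dotE; under eq_bigr => i _ do rewrite big_ord1 !mxE conjc1 mulr1.
by rewrite sumr_const card_ord.
Qed.

Lemma dot_ones_mx m n (W : 'M[R[i]]_(m, n)) :
  dot (ones_mx m n) W = dot (ones m) (W *m ones n).
Proof.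
have -> : ones_mx m n = ones m *m (ones n)^t* :> 'M[R[i]]_(m, n).
  apply/matrixP => i j; rewrite !mxE big_ord1 !mxE mul1r.
  exact: (esym (conjc1 R)).
by rewrite dot_mulr trmxCK.
Qed.

(** For real entries the complex inner product equals its real part, so plainness becomes an
    equation in [R]. *)
Lemma plain_dot m n (B : 'M[R[i]]_(m, n)) : (0 < m)%N -> (0 < n)%N ->
  (forall i j, B i j = (complex.Re (B i j))%:C) ->
  plain B <-> dot (ones_mx m n) B = sigma B 0 * Num.sqrt (m * n)%:R.
Proof.
move=> m0 n0 Breal.
have r0 : Num.sqrt (m * n)%:R != 0 :> R.
  by rewrite gt_eqF // sqrtr_gt0 ltr0n muln_gt0 m0.
have innerE : inner (ones m) (B *m ones n) = (dot (ones_mx m n) B)%:C.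
  rewrite dotC dotE rmorph_sum /inner mxE; apply: eq_bigr => i _.
  rewrite rmorph_sum !mxE mulr_sumr; apply: eq_bigr => j _ /=.
  rewrite !mxE conjc1 !mulr1 -Breal.
  by rewrite -[RHS]mul1r; congr (_ * _); exact: conjc1.
rewrite /plain innerE -fmorphV -rmorphM; split.
  by move=> /complexI ->; rewrite divfK.
by move=> ->; rewrite mulfK.
Qed.

Lemma dot_ones_mx_le m n (W : 'M[R[i]]_(m, n)) : (0 < m)%N -> (0 < n)%N ->
  partial_isometry W -> dot (ones_mx m n) W <= Num.sqrt (m * n)%:R.
Proof.
move=> m0 n0 WI; rewrite dot_ones_mx natrM sqrtrM ?ler0n //.
have sq p : Num.sqrt p%:R ^+ 2 = p%:R :> R by rewrite sqr_sqrtr ?ler0n.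
apply: dot_CS; rewrite ?sqrtr_gt0 ?ltr0n ?sq ?dot_ones //.
by rewrite (le_trans (partial_isometry_le _ WI)) ?dot_ones.
Qed.

Definition sign_mx m n (B : 'M[R[i]]_(m, n)) :=
  forall i j, B i j = 1 \/ B i j = -1.

Lemma sign_mx_real m n (B : 'M[R[i]]_(m, n)) : sign_mx B ->
  forall i j, B i j = (complex.Re (B i j))%:C.
Proof. by move=> Bs i j; case: (Bs i j) => -> //; rewrite ReN rmorphN. Qed.

Lemma dot_sign_mx m n (B : 'M[R[i]]_(m, n)) : sign_mx B -> dot B B = (m * n)%:R.
Proof.
move=> Bs; rewrite dotE.
have B1 i j : complex.Re (B i j * (B i j)^*%C) = 1.
  by case: (Bs i j) => ->; rewrite /=; ring.
under eq_bigr => i _ do under eq_bigr => j _ do rewrite B1.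
by rewrite !sumr_const !card_ord -mulrnA mulnC.
Qed.

(** Both conditions say that [B] divided by the square root of [n] is unitary. *)
Lemma sign_mx_exactly_hadamard n (B : 'M[R[i]]_n) : (0 < n)%N -> sign_mx B ->
  exactly_k_equal_nonzero_sv n B <-> hadamard B.
Proof.
move=> n0 Bs; have n0R : 0 < n%:R :> R by rewrite ltr0n.
have BB := dot_sign_mx Bs; rewrite natrM in BB.
have dot1 : dot (1%:M : 'M[R[i]]_n) 1%:M = n%:R.
  by rewrite /dot trmx1 map_mx1 mulmx1 mxtrace1 -(rmorph_nat (real_complex R)).
split=> [/(exactly_k_partial_isometry n0)|[_ BBn]].
  move=> [W [WI Wn c0 BW]]; set c := sigma B 0 in c0 BW.
  split=> [i j|]; first by case: (Bs i j) => ->; rewrite ?normrN normr1.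
  have cn : c ^+ 2 = n%:R.
    move: BB; rewrite BW dotZl dotZr Wn mulrA -expr2; apply: mulIf.
    by rewrite gt_eqF.
  (* The projection [E] has squared norm [n] and inner product [n] with the identity, so [1 - E] has
     squared norm [n - 2n + n = 0]. *)
  have WW : W *m W^t* = 1%:M.
    set E := W *m W^t*; apply/eqP; rewrite eq_sym -subr_eq0; apply/eqP.
    have -> : 1%:M - E = 1%:C *: 1%:M + (- 1)%:C *: E.
      by rewrite rmorphN rmorph1 scale1r scaleN1r.
    apply: dot_le0_eq0; rewrite dot_sqrD dot1.
    have -> : dot E E = n%:R by rewrite dot_mulr trmxCK WI.
    have -> : dot 1%:M E = n%:R by rewrite dotC dot_mulr trmxCK mul1mx.
    lra.
  rewrite BW ctrmxZ -scalemxAl -scalemxAr scalerA WW -rmorphM -expr2 cn.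
  by rewrite rmorph_nat scalemx1.
set c := Num.sqrt n%:R : R.
have c0 : 0 < c by rewrite sqrtr_gt0.
have cc : c ^+ 2 = n%:R by rewrite sqr_sqrtr // ltW.
set W := (c^-1)%:C *: B.
have BW : B = c%:C *: W by rewrite scalerA -rmorphM divff ?gt_eqF // scale1r.
have WW : W *m W^t* = 1%:M.
  rewrite ctrmxZ -scalemxAl -scalemxAr scalerA BBn -scalemx1 scalerA.
  rewrite -(rmorph_nat (real_complex R)) -!rmorphM.
  rewrite -cc -[RHS]scale1r -(rmorph1 (real_complex R)); congr (_%:C *: _).
  by field; exact: lt0r_neq0.
rewrite BW; apply: (proj2 (partial_isometry_exactly_k _ _ _ _)) => //.
  by rewrite /partial_isometry WW mul1mx.
by rewrite -dot1 -{1}WW dot_mulr trmxCK mul1mx.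
Qed.

End SignMatrices.

(** * The bound for (0,1)-matrices and its equality case *)

Section KyFanZeroOne.
Variable R : rcfType.
Variables (m n k : nat) (A : 'M[R[i]]_(m, n)).
Hypotheses (k0 : (0 < k)%N) (km : (k <= m)%N) (mn : (m <= n)%N).
Hypothesis A01 : zero_one A.

Let B := 2 *: A - ones_mx m n.
Let s : R := Num.sqrt (m * n)%:R.
Let r : R := Num.sqrt k%:R.

Let m0 : (0 < m)%N. Proof. exact: leq_trans k0 km. Qed.
Let n0 : (0 < n)%N. Proof. exact: leq_trans m0 mn. Qed.
Let s0 : 0 < s. Proof. by rewrite sqrtr_gt0 ltr0n muln_gt0 m0. Qed.
Let r0 : 0 < r. Proof. by rewrite sqrtr_gt0 ltr0n. Qed.
Let ss : s ^+ 2 = (m * n)%:R. Proof. by rewrite sqr_sqrtr ?ler0n. Qed.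
Let rr : r ^+ 2 = k%:R. Proof. by rewrite sqr_sqrtr ?ler0n. Qed.

Lemma sign_mx_zero_one : sign_mx B.
Proof.
move=> i j; rewrite !mxE; case: (A01 i j) => ->.
  by right; rewrite mulr0 sub0r.
by left; rewrite mulr1 -addrA subrr addr0.
Qed.

Let BB : dot B B = s ^+ 2.
Proof. by rewrite ss dot_sign_mx //; apply: sign_mx_zero_one. Qed.

Lemma dot_zero_one W : dot A W = 1 / 2 * (dot (ones_mx m n) W + dot B W).
Proof.
have -> : A = (1 / 2)%:C *: (ones_mx m n + B).
  have half2 : (1 / 2)%:C * 2 = 1 :> R[i].
    by rewrite -(rmorph_nat (real_complex R)) -rmorphM divfK ?pnatr_eq0.
  by rewrite /B addrC subrK scalerA half2 scale1r.
by rewrite dotZl dotDl.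
Qed.

Lemma ky_fan_zero_one_le : ky_fan k A <= 1 / 2 * (1 + r) * s.
Proof.
have [W [WI Wk <-]] := ky_fan_attained A km.
have := dot_ones_mx_le m0 n0 WI; rewrite -/s.
have : dot B W <= s * r by apply: dot_CS; rewrite ?BB ?rr.
rewrite dot_zero_one; lra.
Qed.

Lemma ky_fan_zero_one_eq :
  ky_fan k A = 1 / 2 * (1 + r) * s
  <-> plain B /\ exactly_k_equal_nonzero_sv k B.
Proof.
have plainB := plain_dot m0 n0 (sign_mx_real sign_mx_zero_one).
split=> [kyE|[/plainB JB /(exactly_k_partial_isometry k0)[W [WI Wk c0 BW]]]].
  have [W [WI Wk AW]] := ky_fan_attained A km.
  have JWle : dot (ones_mx m n) W <= s := dot_ones_mx_le m0 n0 WI.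
  have BWle : dot B W <= s * r by apply: dot_CS; rewrite ?BB ?rr.
  rewrite kyE dot_zero_one in AW.
  (* The two estimates add up to an equality, so each one is tight. *)
  have JW : dot (ones_mx m n) W = s by lra.
  have BW : dot B W = s * r by lra.
  set c := s / r; have c0 : 0 < c by rewrite divr_gt0.
  have BE : B = c%:C *: W.
    have rB : r%:C *: B = s%:C *: W by apply: dot_CS_eq; rewrite ?BB ?rr.
    rewrite -[LHS]scale1r -(rmorph1 (real_complex R)) -(mulVf (lt0r_neq0 r0)).
    by rewrite rmorphM -scalerA rB scalerA -rmorphM mulrC.
  (* So far only [<=] is known; equality comes from [s^2 = <B, B> = c^2 <W, W>] with [c = s / r]. *)
  have {}Wk : dot W W = k%:R.
    have := BB; rewrite BE dotZl dotZr -rr => WW.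
    rewrite -[LHS](mulKf (lt0r_neq0 c0)) -[c * _](mulKf (lt0r_neq0 c0)) WW /c.
    by field; rewrite !lt0r_neq0.
  have [c_sigma Bk] := partial_isometry_exactly_k k0 c0 WI Wk.
  rewrite -BE in c_sigma Bk; split=> //; apply/plainB.
  by rewrite c_sigma {1}BE dotZr JW.
set c := sigma B 0 in JB c0 BW.
have JW : dot (ones_mx m n) W = s.
  by move: JB; rewrite {1}BW dotZr; apply: mulfI; rewrite lt0r_neq0.
(* Compare [<B, B> = s^2] with [c^2 <W, W> = c^2 k]. *)
have cr : c * r = s.
  apply/eqP; rewrite -(@eqrXn2 _ 2) ?mulr_ge0 ?(ltW c0) ?(ltW r0) ?(ltW s0) //.
  by apply/eqP; rewrite -BB BW dotZl dotZr Wk -rr; ring.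
apply/eqP; rewrite eq_le ky_fan_zero_one_le /=.
(* Testing the norm against [W] gives the lower bound [(s + c k) / 2], where [c k = c r r = s r]. *)
have /(ky_fan_max A km WI) : dot W W <= k%:R by rewrite Wk.
apply: le_trans; rewrite dot_zero_one JW BW dotZl Wk -rr expr2 (mulrA c) cr.
by lra.
Qed.

End KyFanZeroOne.

Theorem theorem15 (R : realType) :
  (forall (m n k : nat) (A : 'M[R[i]]_(m, n)),
     (1 <= k)%N -> (k <= m)%N -> (m <= n)%N -> zero_one A ->
     ky_fan k A
       <= 1 / 2 * (1 + Num.sqrt k%:R) * Num.sqrt (m * n)%:R
     /\ (ky_fan k A
           = 1 / 2 * (1 + Num.sqrt k%:R) * Num.sqrt (m * n)%:R
         <-> plain (2 *: A - ones_mx m n)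
             /\ exactly_k_equal_nonzero_sv k (2 *: A - ones_mx m n)))
  /\
  (forall (n : nat) (A : 'M[R[i]]_n),
     (1 <= n)%N -> zero_one A ->
     (ky_fan n A
        = 1 / 2 * (1 + Num.sqrt n%:R) * Num.sqrt (n * n)%:R
      <-> plain (2 *: A - ones_mx n n) /\ hadamard (2 *: A - ones_mx n n))).
Proof.
split=> [m n k A k0 km mn A01|n A n0 A01].
  by split; [apply: ky_fan_zero_one_le | apply: ky_fan_zero_one_eq].
have := ky_fan_zero_one_eq n0 (leqnn n) (leqnn n) A01.
have := sign_mx_exactly_hadamard n0 (sign_mx_zero_one A01).
tauto.
Qed.
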